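(* Let $P_n$ be the path with vertices $v_1,\dots,v_n$ (consecutive vertices adjacent), and write $n=2^{l_0}p_1^{l_1}p_2^{l_2}\cdots p_t^{l_t}$ with $p_1,\dots,p_t$ distinct odd primes, $l_0\ge 0$ and $l_1,\dots,l_t\ge 1$ ($t\ge 0$). For each $j\in\{1,\dots,t\}$ put $m_j=\frac{p_j-1}{2}$, $k_j=\frac{n}{p_j}$ and $$F_j=\{v_i : i=(m_j+1)+l(2m_j+1),\ 0\le l\le k_j-1\},$$ and let $F=F_1\cup\cdots\cup F_t$ and $\overline{F}=\{v_1,\dots,v_n\}\setminus F$. Then, for each vertex $v$ of $P_n$, the graph $P_n$ is controllable with $v$ selected as the single leader if and only if $v\in\overline{F}$.
   Context: Let $G=(V,E)$ be a graph with Laplacian $\mathbf{L}$ (degree matrix minus adjacency matrix). For $S,T\subset V$, $\mathbf{L}_{S\to T}$ is the submatrix of $\mathbf{L}$ with rows in $S$ and columns in $T$. Given a leader vertex set $W\subset V$ with follower set $U=V\setminus W$, $|U|=N$, the follower dynamics are $\dot{\mathbf{x}}=\mathbf{A}\mathbf{x}+\mathbf{B}\mathbf{u}$ with $\mathbf{A}=\mathbf{L}_{U\to U}$ and $\mathbf{B}=\mathbf{L}_{U\to W}$. $G$ is controllable under the leader set $W$ if this system is controllable, i.e. the matrix $[\mathbf{B},\mathbf{A}\mathbf{B},\mathbf{A}^2\mathbf{B},\dots,\mathbf{A}^{N-1}\mathbf{B}]$ has rank $N$ (vacuously true if $N=0$). *)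

(* Defs.v *)
From HB Require Import structures.
From mathcomp Require Import all_boot all_order all_algebra.

Set Implicit Arguments.
Unset Strict Implicit.
Unset Printing Implicit Defensive.

Import GRing.Theory Num.Theory.

Local Open Scope ring_scope.

Record sgraph := SGraph {
  vertex :> finType;
  adj : rel vertex;
  adj_sym : symmetric adj;
  adj_irr : irreflexive adj
}.

Definition degree (G : sgraph) (x : G) : nat := #|[set y | adj x y]|.

(* Rows and columns are indexed by 'I_#|G|; the index i stands for the vertex
   enum_val i. *)
Definition degree_mx (R : pzRingType) (G : sgraph) : 'M[R]_#|G| :=
  diag_mx (\row_i (degree (enum_val i : G))%:R).

Definition adjacency_mx (R : pzRingType) (G : sgraph) : 'M[R]_#|G| :=
  \matrix_(i, j) (adj (enum_val i : G) (enum_val j))%:R.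

Definition laplacian (R : pzRingType) (G : sgraph) : 'M[R]_#|G| :=
  degree_mx R G - adjacency_mx R G.

Definition laplacian_sub (R : pzRingType) (G : sgraph) (S T : {set G}) :
    'M[R]_(#|S|, #|T|) :=
  mxsub (fun i : 'I_#|S| => enum_rank (enum_val i))
        (fun j : 'I_#|T| => enum_rank (enum_val j)) (laplacian R G).

(* The block row [B, A B, ..., A^(N-1) B]. *)
Definition controllability_mx (R : pzRingType) (N q : nat)
    (A : 'M[R]_N) (B : 'M[R]_(N, q)) : 'M[R]_(N, \sum_(k < N) q) :=
  \mxrow_(k < N) (A ^+ k *m B).

Definition system_controllable (R : fieldType) (N q : nat)
    (A : 'M[R]_N) (B : 'M[R]_(N, q)) : Prop :=
  \rank (controllability_mx A B) = N.

Definition graph_controllable (R : fieldType) (G : sgraph) (W : {set G}) :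
    Prop :=
  let U := ~: W in
  system_controllable (laplacian_sub R U U) (laplacian_sub R U W).

(* The vertex v_i, 1 <= i <= n, is the ordinal of value i - 1. *)
Definition path_adj (n : nat) : rel 'I_n :=
  fun x y => (x.+1 == y :> nat) || (y.+1 == x :> nat).

Lemma path_adj_sym (n : nat) : symmetric (@path_adj n).
Proof. by move=> x y; rewrite /path_adj orbC. Qed.

Lemma path_adj_irr (n : nat) : irreflexive (@path_adj n).
Proof. by move=> x; rewrite /path_adj orbb gtn_eqF. Qed.

Definition path_graph (n : nat) : sgraph :=
  SGraph (@path_adj_sym n) (@path_adj_irr n).

(* The set F_j attached to the odd prime divisor p = p_j of n; x.+1 is the
   1-based index of x. *)
Definition excluded (n p : nat) : {set path_graph n} :=
  let m := (p.-1 %/ 2)%N in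
  let k := (n %/ p)%N in
  [set x : 'I_n | [exists l : 'I_k, x.+1 == (m.+1 + l * (2 * m).+1)%N]].

(* Main.v *)
Require Import Defs.
From HB Require Import structures.
From mathcomp Require Import all_boot all_order all_algebra.
From mathcomp Require Import zify ring.

(* Deleting the leader v = v_(a+1) leaves two paths with a and b = n - 1 - a
   vertices. The polynomials s_k defined by s_0 = 1, s_1 = 1 - X and
   s_(k+2) = (2 - X) s_(k+1) - s_k solve the Laplacian eigenvector equation
   along a path starting from its free end, so that the vector Q equal to
   s_b s_i on one branch and s_a s_i on the other, i being the distance to the
   free end, satisfies X Q = A Q + s_a s_b B. By a degree argument a row vector
   w kills every A^k B iff w Q = 0, that is iff s_b f + s_a g = 0 for two
   arbitrary polynomials f, g of degrees < a and < b. Hence controllability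
   means that s_a and s_b are coprime. Euclid's algorithm, run on the
   reflections s_(a+j) = - s_(a-j) and s_(2a+1+j) = - s_j modulo s_a, shows that
   this happens iff 2a+1 and 2b+1 are coprime; as their sum is 2n, this means
   that no odd prime divisor of n divides 2a+1. *)

Set Implicit Arguments.
Unset Strict Implicit.
Unset Printing Implicit Defensive.

Import GRing.Theory.

(** * Polynomial families with one member in each degree *)

Section GradedFamily.

Local Open Scope ring_scope.

Variables (R : fieldType) (e : nat -> {poly R}).
Hypothesis size_e : forall k, size (e k) = k.+1.

Lemma size_graded_comb (c : nat -> R) (m : nat) :
  (size (\sum_(k < m) c k *: e k)%R <= m)%N.
Proof.
apply/(leq_trans (size_sum _ _ _))/bigmax_leqP => k _.
by rewrite (leq_trans (size_scale_leq _ _)) // size_e.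
Qed.

Lemma graded_free (c : nat -> R) (m : nat) :
  \sum_(k < m) c k *: e k = 0 -> forall k, (k < m)%N -> c k = 0.
Proof.
elim: m => // m IHm; rewrite big_ord_recr /= => sum0.
have cm0 : c m = 0.
  apply: contraTeq (leqnn m) => cm_neq0; rewrite -ltnNge.
  rewrite -size_e -(size_scale _ cm_neq0) -size_polyN.
  by move/eqP: sum0; rewrite addr_eq0 => /eqP <-; apply: size_graded_comb.
move: sum0; rewrite cm0 scale0r addr0 => /IHm c0 k.
by rewrite ltnS leq_eqVlt => /predU1P[->|/c0].
Qed.

Lemma graded_span (m : nat) (f : {poly R}) : (size f <= m)%N ->
  exists c : nat -> R, f = \sum_(k < m) c k *: e k.
Proof.
elim: m f => [|m IHm] f szf.
  exists (fun=> 0); rewrite big_ord0; apply/eqP.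
  by rewrite -size_poly_leq0.
have em_neq0 : (e m)`_m != 0.
  have : lead_coef (e m) != 0 by rewrite lead_coef_eq0 -size_poly_eq0 size_e.
  by rewrite lead_coefE size_e.
have [|c defc] := IHm (f - (f`_m / (e m)`_m) *: e m).
  apply/leq_sizeP => j; rewrite leq_eqVlt coefB coefZ => /predU1P[<-|ltmj].
    by rewrite divfK ?subrr.
  rewrite (nth_default _ (leq_trans szf ltmj)).
  by rewrite [(e m)`_j]nth_default ?size_e // mulr0 subrr.
exists (fun k => if k == m then f`_m / (e m)`_m else c k).
rewrite big_ord_recr /= eqxx -[LHS](subrK ((f`_m / (e m)`_m) *: e m)) defc.
by congr (_ + _); apply: eq_bigr => k _; rewrite ltn_eqF.
Qed.

End GradedFamily.

(** * Coprimality as the absence of small syzygies *)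

Section Resultant.

Local Open Scope ring_scope.

(** This is the nonvanishing of the resultant. If [p] and [q] are coprime, Gauss forces [p] to
    divide [f], which is too small; otherwise the cofactors of the gcd give a nonzero solution. *)
Lemma coprimep_combP (R : fieldType) (p q : {poly R}) :
  p != 0 -> q != 0 ->
  coprimep p q <->
  (forall f g : {poly R}, (size f < size p)%N -> (size g < size q)%N ->
     q * f + p * g = 0 -> f = 0 /\ g = 0).
Proof.
move=> p_neq0 q_neq0; split=> [co_pq f g szf szg /eqP eq0|comb0].
  have f0 : f = 0.
    apply: contraTeq szf => f_neq0; rewrite -leqNgt dvdp_leq //.
    rewrite -(Gauss_dvdpr _ co_pq); move: eq0; rewrite addr_eq0 => /eqP->.
    by rewrite dvdpNr dvdp_mulr.
  by move: eq0; rewrite f0 mulr0 add0r mulf_eq0 (negPf p_neq0) => /eqP.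
pose d := gcdp p q.
have d_neq0 : d != 0 by rewrite gcdp_eq0 (negPf p_neq0).
rewrite /coprimep -/d; apply: contraT => d_neq1.
have d_gt1 : (1 < size d)%N by rewrite ltn_neqAle eq_sym d_neq1 size_poly_gt0.
have defp : p %/ d * d = p by rewrite divpK ?dvdp_gcdl.
have defq : q %/ d * d = q by rewrite divpK ?dvdp_gcdr.
have quo_small (r : {poly R}) : r != 0 -> (size (r %/ d)%R < size r)%N.
  move=> r_neq0; rewrite size_divp // ltn_subrL -subn1 subn_gt0 d_gt1.
  by rewrite size_poly_gt0.
have [|||] := comb0 (p %/ d) (- (q %/ d)); rewrite ?size_polyN ?quo_small //.
  by rewrite -{1}defq -{2}defp; ring.
by move=> p0; move: p_neq0; rewrite -defp p0 mul0r eqxx.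
Qed.

End Resultant.

(** * The polynomials s_k and their divisibility relations *)

Section PathPoly.

Local Open Scope ring_scope.

Variable R : fieldType.

(** Carrying two consecutive terms makes the recurrence structural. The term s_k is det(M - X) for
    the block M of the system matrix on a branch of k followers; over the reals it is the Chebyshev
    polynomial of the third kind V_k at 1 - X/2. *)
Fixpoint path_poly_pair (k : nat) : {poly R} * {poly R} :=
  if k is k'.+1 then
    let: (s, t) := path_poly_pair k' in (t, (2%:R - 'X) * t - s)
  else (1, 1 - 'X).

Definition path_poly (k : nat) : {poly R} := (path_poly_pair k).1.

Notation s := path_poly.

Lemma path_poly0 : s 0 = 1. Proof. by []. Qed.

Lemma path_poly1 : s 1 = 1 - 'X. Proof. by []. Qed.

Lemma path_polySS k : s k.+2 = (2%:R - 'X) * s k.+1 - s k.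
Proof. by rewrite /s /=; case: (path_poly_pair k). Qed.

Lemma size_path_poly k : size (s k) = k.+1.
Proof.
have szX c : size (c%:P - 'X : {poly R}) = 2.
  by rewrite -size_polyN opprB size_XsubC.
suff [] : size (s k) = k.+1 /\ size (s k.+1) = k.+2 by [].
elim: k => [|k [IHk IHk1]]; first by rewrite path_poly1 size_poly1 szX.
split=> //; rewrite path_polySS -polyC_natr size_polyDl.
  by rewrite size_proper_mul ?szX ?IHk1 // mulf_neq0 // lead_coef_eq0
     -size_poly_eq0 ?szX ?IHk1.
rewrite size_polyN size_proper_mul ?szX ?IHk1 ?IHk //.
by rewrite mulf_neq0 // lead_coef_eq0 -size_poly_eq0 ?szX ?IHk1.
Qed.

Lemma path_poly_neq0 k : s k != 0.
Proof. by rewrite -size_poly_eq0 size_path_poly. Qed.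

(** The sum s_(a+j) + s_(a-j) obeys the recurrence in j, with initial values 2 s_a and (2 - X)
    s_a. *)
Lemma path_poly_reflect a j : (j <= a)%N -> s a %| s (a + j) + s (a - j).
Proof.
(* Two consecutive indices are carried; [i < a] keeps both subtractions exact. *)
suff H i : (i < a)%N -> s a %| s (a + i) + s (a - i) /\
    s a %| s (a + i.+1) + s (a - i.+1).
  case: j => [_|j /H[]//].
  by rewrite addn0 subn0 -mulr2n -mulr_natr dvdp_mulr.
elim: i => [lt0a|i IHi ltia].
  rewrite addn0 subn0 -mulr2n -mulr_natr dvdp_mulr //; split=> //.
  case: a lt0a => // a _; rewrite addn1 subn1 path_polySS /= subrK.
  by rewrite dvdp_mull.
have [dvi dvi1] := IHi (ltnW ltia); split=> //.
have -> : (a + i.+2 = (a + i).+2)%N by lia.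
have defi : (a - i = (a - i.+2).+2)%N by lia.
have defi1 : (a - i.+1 = (a - i.+2).+1)%N by lia.
move: dvi dvi1; rewrite defi defi1 addnS !path_polySS.
set x := s (a + i).+1; set y := s _.+1; set z := s (_ - _); set w := s (a + i).
move=> dvi dvi1.
have -> : (2%:R - 'X) * x - w + z =
    (2%:R - 'X) * (x + y) - (w + ((2%:R - 'X) * y - z)) by ring.
by rewrite dvdp_sub // dvdp_mull.
Qed.

(** Extended backwards, the recurrence gives s_(-1-j) = s_j, and reflection about a sends 2a+1+j to
    -1-j. *)
Lemma path_poly_shift a j : s a %| s (a.*2.+1 + j) + s j.
Proof.
have dv0 : s a %| s a.*2 + s 0.
  by have := path_poly_reflect (leqnn a); rewrite addnn subnn.
suff [] : s a %| s (a.*2.+1 + j) + s j /\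
    s a %| s (a.*2.+1 + j.+1) + s j.+1 by [].
have step x y z t : s a %| x + y -> s a %| z + t ->
    s a %| (2%:R - 'X) * x - z + ((2%:R - 'X) * y - t).
  move=> dvxy dvzt.
  have -> : (2%:R - 'X) * x - z + ((2%:R - 'X) * y - t) =
    (2%:R - 'X) * (x + y) - (z + t) by ring.
  by rewrite dvdp_sub // dvdp_mull.
(* For a > 0, one recurrence step from the reflections j = a-1 and j = a avoids the index -1, since
   (2 - X) s_0 - s_1 = s_0. *)
have dv1 : s a %| s a.*2.+1 + s 0.
  case: a dv0 step => [|a] dv0 step; first by rewrite dvd1p.
  have := path_poly_reflect (leqnSn a); rewrite addSn addnn subSn // subnn.
  move=> /(step _ _ _ _ dv0); rewrite doubleS [s _.+3]path_polySS.
  by rewrite path_poly1 path_poly0; congr (_ %| _); ring.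
elim: j => [|j [IHj IHj1]].
  rewrite addn0 addn1; split=> //; rewrite path_polySS path_poly1.
  have := step _ _ _ _ dv1 dv0; rewrite path_poly0.
  by congr (_ %| _); ring.
split=> //.
move: IHj IHj1; rewrite !addnS; move: (a.*2.+1 + j)%N => i IHj IHj1.
by rewrite !path_polySS; apply: step.
Qed.

(** Strong induction on a + b with a <= b: replacing b by b - (2a+1) or by 2a - b turns 2b+1 into
    (2b+1) - 2(2a+1) or 2(2a+1) - (2b+1), so coprimality is preserved on both sides. *)
Lemma coprimep_path_poly a b :
  coprimep (s a) (s b) = coprime a.*2.+1 b.*2.+1.
Proof.
have co_dv (p q r : {poly R}) : p %| q + r -> coprimep p q = coprimep p r.
  move=> /dvdpP[u defqr]; have -> : q = u * p + (- r) by rewrite -defqr addrK.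
  by rewrite coprimep_addl_mul -scaleN1r coprimepZr // oppr_eq0 oner_eq0.
have [m] := ubnP (a + b); elim: m a b => // m IHm a b.
wlog leab : a b / (a <= b)%N => [W|lt_m].
  case/orP: (leq_total a b) => [/W//|leba lt_m].
  by rewrite coprimep_sym coprime_sym W // addnC.
have [defa | a_gt0] := posnP a.
  by rewrite defa path_poly0 coprime1p /coprime gcd1n.
have [lt2ab | le_b2a] := ltnP a.*2 b.
  rewrite -(subnKC lt2ab) (co_dv _ _ _ (path_poly_shift _ _)) IHm; last lia.
  have -> : ((a.*2.+1 + (b - a.*2.+1)).*2.+1 =
    2 * a.*2.+1 + (b - a.*2.+1).*2.+1)%N by lia.
  by rewrite /coprime gcdnMDl.
(* For b = a > 0 both sides are false. *)
move: leab; rewrite leq_eqVlt => /predU1P[<-|ltab].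
  rewrite /coprimep /coprime gcdnn gcdpp size_path_poly; lia.
have defb : b = (a + (b - a))%N by lia.
rewrite {1}defb (co_dv _ _ _ (path_poly_reflect _)); last lia.
rewrite IHm; last lia.
have -> : ((a - (b - a)).*2.+1 = a.*2.+1 * 2 - b.*2.+1)%N by lia.
rewrite /coprime; congr (_ == 1)%N.
set A := a.*2.+1; set B := b.*2.+1.
have leBA : (B <= A * 2)%N by rewrite /A /B; lia.
apply/eqP; rewrite eqn_dvd !dvdn_gcd !dvdn_gcdl /=.
have dvA : (gcdn A (A * 2 - B) %| A * 2)%N by rewrite dvdn_mulr ?dvdn_gcdl.
apply/andP; split.
  by rewrite -(dvdn_subr leBA) // dvdn_gcdr.
by rewrite dvdn_subr ?dvdn_gcdr // dvdn_mulr ?dvdn_gcdl.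
Qed.

End PathPoly.

(** * Controllability through row vectors killing every A^k B *)

Section Krylov.

Local Open Scope ring_scope.

Lemma size_map_polyC_mulmx (R : fieldType) (N q : nat) (w : 'rV[R]_N)
    (Q : 'M[{poly R}]_(N, q)) i j :
  (forall i j, size (Q i j) <= N)%N ->
  (size ((map_mx polyC w *m Q) i j) <= N)%N.
Proof.
move=> szQ; rewrite mxE; apply/(leq_trans (size_sum _ _ _))/bigmax_leqP => k _.
by rewrite mxE mul_polyC (leq_trans (size_scale_leq _ _)).
Qed.

Lemma controllable_row_freeP (R : fieldType) (N q : nat)
    (A : 'M[R]_N) (B : 'M[R]_(N, q)) :
  system_controllable A B <->
  (forall w : 'rV_N, (forall k : 'I_N, w *m (A ^+ k *m B) = 0) -> w = 0).
Proof.
split=> [/eqP rkN w w0|w0].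
  apply: (row_free_inj (A := controllability_mx A B)) => //.
  rewrite mul0mx /controllability_mx mul_mxrow -[RHS]mxrow0.
  exact/eq_mxrowP.
apply/eqP/inj_row_free => w; rewrite mul_mxrow -[RHS]mxrow0 => /eq_mxrowP.
exact: w0.
Qed.

(* [Q] plays the role of [adj (X - A) B]: compare degrees in
   [X^k w Q = w A^k Q], resp. in [chi w A^k B = - w A^(k+1) Q]. *)
Lemma krylov_kernelP (R : fieldType) (N q : nat) (A : 'M[R]_N)
    (B : 'M[R]_(N, q)) (Q : 'M[{poly R}]_(N, q)) (chi : {poly R})
    (w : 'rV[R]_N) :
  (forall i j, size (Q i j) <= N)%N -> (N < size chi)%N ->
  'X *: Q = map_mx polyC A *m Q + chi *: map_mx polyC B ->
  (forall k : 'I_N, w *m (A ^+ k *m B) = 0) <-> map_mx polyC w *m Q = 0.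
Proof.
move=> szQ sz_chi defQ.
have step k : 'X *: (map_mx polyC (w *m A ^+ k) *m Q) =
    map_mx polyC (w *m A ^+ k.+1) *m Q +
    chi *: map_mx polyC (w *m (A ^+ k *m B)).
  by rewrite scalemxAr defQ mulmxDr exprSr !map_mxM -!mulmxA -!scalemxAr.
split=> [wAB0 | wQ0 k].
  have powX k : (k <= N)%N ->
      'X^k *: (map_mx polyC w *m Q) = map_mx polyC (w *m A ^+ k) *m Q.
    elim: k => [|k IHk] ltkN; first by rewrite expr0 scale1r mulmx1.
    rewrite exprS -scalerA IHk ?(ltnW ltkN) // step.
    by rewrite (wAB0 (Ordinal ltkN)) map_mx0 scaler0 addr0.
  apply/matrixP=> i j; rewrite [RHS]mxE; apply: contraTeq (leqnn N) => wQ_neq0.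
  rewrite -ltnNge; apply: leq_trans (size_map_polyC_mulmx (w *m A ^+ N) i j szQ).
  rewrite -powX // mxE mulrC size_mulXn //.
  by rewrite -[X in (X < _)%N]addn0 ltn_add2l size_poly_gt0.
suff: map_mx polyC (w *m A ^+ k) *m Q = 0 /\ w *m (A ^+ k *m B) = 0 by case.
have kill l : map_mx polyC (w *m A ^+ l) *m Q = 0 ->
    map_mx polyC (w *m A ^+ l.+1) *m Q = 0 /\ w *m (A ^+ l *m B) = 0.
  move=> wQ0l; have := step l; rewrite wQ0l scaler0.
  move=> /esym/eqP; rewrite addr_eq0 => /eqP eqQB.
  have wB0 : w *m (A ^+ l *m B) = 0.
    apply/matrixP=> i j; rewrite [RHS]mxE; apply: contraTeq sz_chi => wB_neq0.
    rewrite -leqNgt.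
    apply: leq_trans (size_map_polyC_mulmx (w *m A ^+ l.+1) i j szQ).
    rewrite eqQB !mxE size_polyN mulrC mul_polyC size_scale //.
    by move: wB_neq0; rewrite !mxE.
  by rewrite eqQB wB0 map_mx0 scaler0 oppr0.
elim: (val k) => [|l [/kill[wQ0l _] _]].
  by rewrite mulmx1; split=> //; have [] := kill 0; rewrite ?mulmx1.
by split=> //; have [] := kill _ wQ0l.
Qed.

End Krylov.

(** * The Laplacian eigenvector equation away from the leader *)

Section LaplacianResolvent.

Local Open Scope ring_scope.

Lemma laplacian_subE (R : pzRingType) (G : sgraph) (S T : {set G}) i j :
  laplacian_sub R S T i j =
    (degree (enum_val i))%:R *+ (enum_val i == enum_val j) -
    (adj (enum_val i) (enum_val j))%:R.
Proof. by rewrite !mxE !enum_rankK (inj_eq enum_rank_inj). Qed.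

(** This supplies the hypothesis of [krylov_kernelP] with [F v] as [chi]: in the Laplacian row of a
    follower, the leader's column is split off as the term in [B]. *)
Lemma laplacian_single_leader (R : fieldType) (G : sgraph) (v : G)
    (F : G -> {poly R}) :
  (forall x, x != v -> 'X * F x = \sum_(y | adj x y) (F x - F y)) ->
  let Q := \matrix_(i < #|~: [set v]|, j < #|[set v]|) F (enum_val i) in
  'X *: Q = map_mx polyC (laplacian_sub R (~: [set v]) (~: [set v])) *m Q +
            F v *: map_mx polyC (laplacian_sub R (~: [set v]) [set v]).
Proof.
move=> eqF Q; apply/matrixP => i j; set x : G := enum_val i.
have xv : x != v by have := enum_valP i; rewrite !inE.
have jv : enum_val j = v by have := enum_valP j; rewrite inE => /eqP.
pose c y : {poly R} := ((degree x)%:R *+ (x == y) - (adj x y)%:R)%:P.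
rewrite [RHS]mxE.
have -> : (map_mx polyC (laplacian_sub R (~: [set v]) (~: [set v])) *m Q) i j =
    \sum_(y in ~: [set v]) c y * F y.
  rewrite mxE [RHS]big_enum_val; apply: eq_bigr => k _.
  by rewrite !mxE !enum_rankK (inj_eq enum_rank_inj).
have -> : (F v *: map_mx polyC (laplacian_sub R (~: [set v]) [set v])) i j =
    F v * c v by rewrite !mxE !enum_rankK (inj_eq enum_rank_inj) jv.
have -> : \sum_(y in ~: [set v]) c y * F y + F v * c v = \sum_y c y * F y.
  rewrite [RHS](bigD1 v) //= addrC mulrC; congr (_ + _).
  by apply: eq_bigl => y; rewrite !inE.
rewrite !mxE -/x eqF // sumrB sumr_const -[#|_|]cardsE -/(degree x).
rewrite (big_mkcond (adj x)) /= /c.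
under [RHS]eq_bigr => y _ do rewrite polyCB mulrBl.
rewrite sumrB; congr (_ - _).
  rewrite (bigD1 x) //= eqxx big1 ?addr0 => [|y /negPf neq_yx].
    by rewrite polyC_natr mulr_natl.
  by rewrite eq_sym neq_yx mul0r.
by apply: eq_bigr => y _; case: adj; rewrite ?mul1r ?mul0r.
Qed.

End LaplacianResolvent.

(** * The explicit solution on the two branches of the path *)

Section PathLeader.

Local Open Scope ring_scope.

Lemma sum_path_adj (V : nmodType) (n : nat) (x : 'I_n) (f : nat -> V) :
  \sum_(y < n | path_adj x y) f y =
    (if (0 < x)%N then f x.-1 else 0) + (if (x.+1 < n)%N then f x.+1 else 0).
Proof.
rewrite (bigID (fun y : 'I_n => y.+1 == x)) /=; congr (_ + _).
  case: posnP => [x0|x_gt0].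
    by rewrite big_pred0 // => y; rewrite x0 andbF.
  have ltx : (x.-1 < n)%N by have := ltn_ord x; lia.
  rewrite (big_pred1 (Ordinal ltx)) // => y.
  by rewrite /= -(inj_eq val_inj) /path_adj /=; apply/idP/idP; lia.
case: ifP => ltx.
  rewrite (big_pred1 (Ordinal ltx)) // => y.
  by rewrite /= -(inj_eq val_inj) /path_adj /=; apply/idP/idP; lia.
rewrite big_pred0 // => y; have ltyn := ltn_ord y.
by rewrite /path_adj; apply/negbTE; lia.
Qed.

(* The two expressions agree at [k = v], where both equal [s_v s_(n-1-v)]. *)
Definition leader_resolvent (R : fieldType) (n v k : nat) : {poly R} :=
  if (k <= v)%N then path_poly R (n - v.+1) * path_poly R k
  else path_poly R v * path_poly R (n - k.+1).

(** On each side of v one factor is constant, which leaves the recurrence of s from the free end.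
    [F_le] and [F_ge] both include k = v, so neighbours of the leader need no separate case. *)
Lemma leader_resolvent_eq (R : fieldType) (n : nat) (v x : 'I_n) : x != v ->
  'X * leader_resolvent R n v x =
    \sum_(y < n | path_adj x y)
      (leader_resolvent R n v x - leader_resolvent R n v y).
Proof.
set F := leader_resolvent R n v; move=> neq_xv.
rewrite (sum_path_adj x (fun k => F x - F k)).
have F_le k : (k <= v)%N -> F k = path_poly R (n - v.+1) * path_poly R k.
  by rewrite /F /leader_resolvent => ->.
have F_ge k : (v <= k)%N -> F k = path_poly R v * path_poly R (n - k.+1).
  rewrite /F /leader_resolvent leq_eqVlt => /predU1P[<-|].
    by rewrite leqnn mulrC.
  by rewrite ltnNge => /negPf->.
have := ltn_ord x; have := ltn_ord v.
have [ltxv|] := ltnP x v; last first.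
  rewrite leq_eqVlt eq_sym (inj_eq val_inj) (negPf neq_xv) /= => ltvx _ ltxn.
  rewrite (leq_ltn_trans _ ltvx) // !F_ge; [|lia|lia|lia].
  case: ifP => ltx1n.
    have -> : (n - x.-1.+1 = (n - x.+2).+2)%N by lia.
    have -> : (n - x.+1 = (n - x.+2).+1)%N by lia.
    by rewrite path_polySS; ring.
  (* Here x is the free end, and its single neighbour turns the equation into X s_0 = s_0 - s_1. *)
  have -> : (n - x.-1.+1 = 1)%N by lia.
  have -> : (n - x.+1 = 0)%N by lia.
  by rewrite path_poly1 path_poly0; ring.
move=> ltvn ltxn; rewrite (leq_trans _ ltvn) ?ltnS // !F_le; [|lia|lia|lia].
case: posnP => [->|x_gt0].
  by rewrite path_poly1 path_poly0; ring.
case: (x : nat) x_gt0 => //= k _.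
by rewrite path_polySS; ring.
Qed.

End PathLeader.

(** * Controllability as coprimality of the two branch polynomials *)

Section PathControllable.

Local Open Scope ring_scope.

Notation s := path_poly.

Lemma sum_leader_resolvent (R : fieldType) (n : nat) (v : 'I_n)
    (c : nat -> R) :
  \sum_(x < n | x != v) c x *: leader_resolvent R n v x =
    s R (n - v.+1) * (\sum_(k < v) c k *: s R k) +
    s R v * (\sum_(k < n - v.+1) c (n - k.+1)%N *: s R k).
Proof.
set G := fun k => c k *: leader_resolvent R n v k.
have -> : \sum_(x < n | x != v) G x = \sum_(0 <= k < n | k != v) G k.
  by rewrite big_mkord.
rewrite (big_cat_nat (n := v)) //=; last exact: ltnW.
rewrite (big_ltn_cond (m := v)) // eqxx /=; congr (_ + _).
  rewrite big_nat_cond [RHS]big_distrr /= -(big_mkord xpredT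
    (fun k => s R (n - v.+1) * (c k *: s R k))) [RHS]big_nat_cond.
  apply: eq_big => k; first by lia.
  case/andP=> ltkv _.
  by rewrite /G /leader_resolvent ltnW // scalerAr.
(* Reversing one sum and shifting the other by v + 1 matches distances to the free end n - 1 with
   vertices. *)
rewrite [RHS]big_distrr /= -(big_mkord xpredT
  (fun k => s R v * (c (n - k.+1)%N *: s R k))) [RHS]big_nat_rev.
rewrite -[v.+1]add0n big_addn big_nat_cond [RHS]big_nat_cond add0n.
apply: eq_big => k; first by lia.
case/andP=> /andP[_ ltk] _; rewrite /G /leader_resolvent.
rewrite leqNgt addnS ltnS leq_addl /= -scalerAr.
by congr (c _ *: (_ * s R _)); lia.
Qed.

(** The coordinates of w on the two branches are the coefficients of f and g in the basis s_k, so
    the w killing every A^k B are the relations s_b f + s_a g = 0 of [coprimep_combP]. *)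
Lemma path_controllable_coprimep (R : fieldType) (n : nat)
    (v : path_graph n) :
  graph_controllable R [set v] <->
  coprimep (s R v) (s R (n - (v : 'I_n).+1)).
Proof.
have ltvn := ltn_ord (v : 'I_n).
have cardU : #|~: [set v]| = n.-1.
  by have := cardsC1 v; rewrite card_ord.
pose F (x : path_graph n) := leader_resolvent R n v (x : 'I_n).
have eqF x : x != v -> 'X * F x = \sum_(y | adj x y) (F x - F y).
  exact: leader_resolvent_eq.
have := laplacian_single_leader eqF; set Q := (\matrix_(_, _) _) => /= defQ.
have sz_mul k l : size (s R k * s R l) = (k + l).+1.
  by rewrite size_mul ?path_poly_neq0 // !size_path_poly addnS.
have szQ i j : (size (Q i j) <= #|~: [set v]|)%N.
  have := enum_valP i; rewrite mxE /F cardU; move: (enum_val i) => x.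
  rewrite !inE -(inj_eq val_inj) /leader_resolvent => neq_xv.
  have ltxn := ltn_ord (x : 'I_n).
  by case: (leqP (x : 'I_n) v) => le_xv; rewrite sz_mul; move: neq_xv le_xv => /=; lia.
(* [F v] is s_a s_b, whose degree n - 1 is the number of followers. *)
have sz_chi : (#|~: [set v]| < size (F v))%N.
  by rewrite cardU /F /leader_resolvent leqnn sz_mul; lia.
have wQ0 (c : nat -> R) (w : 'rV_#|~: [set v]|) :
  (forall i, w 0 i = c (enum_val i : 'I_n)) ->
  map_mx polyC w *m Q = 0 <->
  s R (n - v.+1) * (\sum_(k < v) c k *: s R k) +
    s R v * (\sum_(k < n - v.+1) c (n - k.+1)%N *: s R k) = 0.
  move=> wc; rewrite -sum_leader_resolvent.
  have E j : (map_mx polyC w *m Q) 0 j =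
      \sum_(x < n | x != v) c x *: leader_resolvent R n v x.
    rewrite mxE; transitivity (\sum_(x in ~: [set v]) c (x : 'I_n) *: F x).
      rewrite [RHS]big_enum_val; apply: eq_bigr => i _.
      by rewrite !mxE wc mul_polyC.
    by apply: eq_bigl => x; rewrite !inE.
  split=> [wQ|sum0].
    have card1 : (0 < #|[set v]|)%N by rewrite cards1.
    by rewrite -(E (Ordinal card1)) wQ mxE.
  by apply/matrixP => i j; rewrite ord1 E sum0 mxE.
rewrite coprimep_combP ?path_poly_neq0 // !size_path_poly.
rewrite /graph_controllable controllable_row_freeP.
split=> [ctrl f g | comb0 w].
  rewrite !ltnS => /(graded_span (size_path_poly R))[cf deff].
  move=> /(graded_span (size_path_poly R))[cg defg] sum0.
  (* The two coefficient families are glued into one indexed by vertices, [cg] being read from the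
     end n - 1. *)
  pose c k := if (k < v)%N then cf k else cg (n - k.+1)%N.
  have deff' : f = \sum_(k < v) c k *: s R k.
    by rewrite deff; apply: eq_bigr => k _; rewrite /c ltn_ord.
  have defg' : g = \sum_(k < n - v.+1) c (n - k.+1)%N *: s R k.
    rewrite defg; apply: eq_bigr => k _; have ltk := ltn_ord k.
    rewrite /c ifF; last by apply/negbTE; lia.
    by congr (cg _ *: _); lia.
  pose w : 'rV_#|~: [set v]| := \row_i c (enum_val i : 'I_n).
  have w0 : w = 0.
    apply: ctrl; apply/(krylov_kernelP w szQ sz_chi defQ).
    by apply/(wQ0 c) => [i|]; rewrite ?mxE // -deff' -defg'.
  have c0 k : (k < n)%N -> k != v -> c k = 0.
    move=> ltkn neq_kv; pose x : path_graph n := Ordinal ltkn.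
    have xU : x \in ~: [set v] by rewrite !inE -(inj_eq val_inj).
    have := congr1 (fun u : 'rV_ _ => u 0 (enum_rank_in xU x)) w0.
    by rewrite !mxE enum_rankK_in.
  rewrite deff' defg'; split; apply: big1 => k _; have ltk := ltn_ord k.
    by rewrite c0 ?scale0r //; lia.
  by rewrite c0 ?scale0r //; lia.
move=> /(krylov_kernelP w szQ sz_chi defQ) wQ.
(* The sum has one term when k is a follower and is empty otherwise: it extends w by zero. *)
pose c k := \sum_(i | (enum_val i : 'I_n) == k :> nat) w 0 i.
have wc i : w 0 i = c (enum_val i : 'I_n).
  rewrite /c (big_pred1 i) // => j /=.
  by rewrite (inj_eq val_inj) (inj_eq enum_val_inj).
have /(wQ0 _ _ wc)/comb0[||f0 g0] := wQ.
- by rewrite ltnS size_graded_comb //; apply: size_path_poly.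
- by rewrite ltnS (size_graded_comb _ (fun k => c (n - k.+1)%N)) //;
    apply: size_path_poly.
apply/rowP => i; rewrite wc mxE.
have := enum_valP i; rewrite !inE -(inj_eq val_inj).
move: (enum_val i) => x; have ltxn := ltn_ord (x : 'I_n).
case: (ltngtP x v) => // [ltxv|ltvx] _.
  exact: (graded_free (size_path_poly R) f0).
have := graded_free (size_path_poly R) (c := fun k => c (n - k.+1)%N) g0.
by move=> /(_ (n - x.+1)%N); rewrite subnSK // subKn; [apply; lia | lia].
Qed.

End PathControllable.

(** * The arithmetic of the excluded sets *)

Lemma mem_excluded (n p : nat) (v : path_graph n) :
  odd p -> p %| n -> (v \in excluded n p) = (p %| (v : 'I_n).*2.+1).
Proof.
move=> p_odd /dvdnP[k defn]; have p_gt0 : 0 < p by case: p p_odd {defn}.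
have ltvn := ltn_ord (v : 'I_n).
have defp : p = (2 * (p.-1 %/ 2)).+1 by lia.
(* With p = 2m+1 and i = v+1, the equation i = m+1+lp amounts to 2v+1 = (2l+1)p. *)
rewrite inE; apply/existsP/dvdnP => [[l /eqP]|[c defc]].
  move: (val l) => m; rewrite -defp => defv; exists (2 * m).+1; nia.
(* As 2v+1 is odd, c = 2l+1 with l = [c./2]; the bound on l comes from 2v+1 < 2n. *)
have c_odd : odd c.
  by have := congr1 odd defc; rewrite oddM p_odd andbT /= odd_double.
have ltc : c./2 < n %/ p by rewrite defn mulnK //; nia.
by exists (Ordinal ltc); rewrite -defp /=; apply/eqP; nia.
Qed.

Theorem mainTheorem4 (R : realFieldType) (n l0 t : nat) (p l : 'I_t -> nat)
    (p_prime : forall j, prime (p j)) (p_odd : forall j, odd (p j))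
    (p_inj : injective p) (l_gt0 : forall j, 0 < l j)
    (n_fact : n = 2 ^ l0 * \prod_(j < t) p j ^ l j)
    (v : path_graph n) :
  graph_controllable R [set v] <->
  v \in ~: (\bigcup_(j < t) excluded n (p j)).
Proof.
have ltvn := ltn_ord (v : 'I_n).
have p_dvdn j : p j %| n.
  by rewrite n_fact (bigD1 j) //= dvdn_mull // dvdn_mulr // dvdn_exp.
rewrite path_controllable_coprimep coprimep_path_poly in_setC.
set A := _.*2.+1; set B := _.*2.+1.
suff -> : (v \notin \bigcup_(j < t) excluded n (p j)) = coprime A B by [].
(* Hence a divisor of n that divides A also divides B. *)
have defAB : A + B = 2 * n by rewrite /A /B; lia.
apply/idP/idP; last first.
  apply: contraTN => /bigcupP[j _]; rewrite mem_excluded // -/A => dvA.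
  have dvB : p j %| B by rewrite -(dvdn_addr _ dvA) defAB dvdn_mull.
  apply/negP => /eqP co_AB; have := prime_gt1 (p_prime j).
  by rewrite ltnNge -{}co_AB dvdn_leq ?gcdn_gt0 // dvdn_gcd dvA dvB.
(* A prime q dividing A and B is odd, as A is, and divides 2n; so it divides n and is one of the
   p_j. *)
apply: contraR => nco_AB; pose q := pdiv (gcdn A B).
have q_prime : prime q.
  by rewrite pdiv_prime // ltn_neqAle eq_sym nco_AB gcdn_gt0.
have [dvA dvB] : q %| A /\ q %| B.
  by apply/andP; rewrite -dvdn_gcd pdiv_dvd.
have q_neq2 : q != 2.
  by apply: contraTneq dvA => ->; rewrite dvdn2 /A /= odd_double.
have : q %| n.
  have : q %| 2 * n by rewrite -defAB dvdn_add.
  by rewrite Euclid_dvdM // dvdn_prime2 // (negPf q_neq2).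
rewrite [X in _ %| X]n_fact Euclid_dvdM // Euclid_dvdX // dvdn_prime2 // (negPf q_neq2) /=.
rewrite Euclid_dvd_prod // big_has => /hasP[j _].
rewrite Euclid_dvdX // dvdn_prime2 // => /andP[/eqP defq _].
by apply/bigcupP; exists j; rewrite // mem_excluded // -defq.
Qed.
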